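(* The $\mathbb{Q}$-linear map $\theta:\mathfrak{H}^0\to\mathbb{R}$ with $\theta(1)=1$ and $\theta(z_{i_1}\cdots z_{i_k})=t(i_1,\dots,i_k)$ for every word with $i_1>1$ is an algebra homomorphism from $(\mathfrak{H}^0,* )$ to $\mathbb{R}$, i.e. $\theta(u*v)=\theta(u)\theta(v)$ for all $u,v\in\mathfrak{H}^0$.
   Context: Let $\mathfrak{H}^1$ be the $\mathbb{Q}$-vector space with basis the words (including the empty word $1$) in the noncommuting letters $z_1,z_2,\dots$. Define a product $*$ bilinearly by $w*1=1*w=w$ and, for words $w_1,w_2$ and positive integers $i,j$, $z_iw_1*z_jw_2=z_i(w_1*z_jw_2)+z_j(z_iw_1*w_2)+z_{i+j}(w_1*w_2)$; this makes $\mathfrak{H}^1$ a commutative algebra. Let $\mathfrak{H}^0$ be the subspace spanned by $1$ and the words whose first letter is $z_i$ with $i>1$; it is a subalgebra. For positive integers $i_1,\dots,i_k$ with $i_1\ge 2$, $t(i_1,\dots,i_k)=\sum_{n_1>\cdots>n_k\ge 1,\ n_j\text{ odd}} n_1^{-i_1}\cdots n_k^{-i_k}$. *)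

(* Defs.v *)
From HB Require Import structures.
From mathcomp Require Import all_boot all_order all_algebra.
From mathcomp Require Import finmap.
From mathcomp Require Import all_classical all_reals all_analysis.
(* The notations of monalg are incompatible with those of MathComp-Analysis. *)
From mathcomp Require Import -(notations) monalg.

Set Implicit Arguments.
Unset Strict Implicit.
Unset Printing Implicit Defensive.

Import Order.TTheory GRing.Theory Num.Theory.
Local Open Scope ring_scope.

(* The letter z_i is encoded by its index i. *)
Definition letter := {i : nat | (0 < i)%N}.
Definition word := seq letter.
HB.instance Definition _ := SubChoice.on letter.
HB.instance Definition _ := Choice.on word.

Lemma addl_proof (i j : letter) : (0 < val i + val j)%N.
Proof. by rewrite addn_gt0 (valP i). Qed.

Definition addl (i j : letter) : letter := Sub (val i + val j)%N (addl_proof i j).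

Lemma addlC : commutative addl.
Proof. by move=> i j; apply: val_inj; rewrite /= addnC. Qed.

Lemma addlA : associative addl.
Proof. by move=> i j k; apply: val_inj; rewrite /= addnA. Qed.

Definition H1 : Type := malg word rat.
HB.instance Definition _ := GRing.Lmodule.on H1.

Definition wd (w : word) : H1 := mkmalgU w 1.

Definition linext (V : lmodType rat) (h : word -> V) (u : H1) : V :=
  \sum_(w <- msupp u) mcoeff w u *: h w.

Section Linext.
Variables (V : lmodType rat) (h : word -> V).

Lemma linextE (d : {fset word}) (u : H1) : (msupp u `<=` d)%fset ->
  linext h u = \sum_(w <- d) mcoeff w u *: h w.
Proof.
move=> le; rewrite [LHS](big_fset_incl _ le) => //= x xd /mcoeff_outdom ->.
by rewrite scale0r.
Qed.

Lemma linext_is_linear : linear (linext h).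
Proof.
move=> c u v.
pose d := (msupp u `|` msupp v)%fset.
have du : (msupp u `<=` d)%fset by apply: fsubsetUl.
have dv : (msupp v `<=` d)%fset by apply: fsubsetUr.
have duv : (msupp (c *: u + v)%R `<=` d)%fset.
  apply: fsubset_trans (msuppD_le _ _) _; apply: fsetSU; exact: msuppZ_le.
rewrite (linextE du) (linextE dv) (linextE duv) scaler_sumr -big_split /=.
by apply: eq_bigr => w _; rewrite mcoeffD mcoeffZ scalerDl scalerA.
Qed.

HB.instance Definition _ :=
  GRing.isLinear.Build rat H1 V _ (linext h) linext_is_linear.

Lemma linext_wd w : linext h (wd w) = h w.
Proof.
by rewrite (linextE (d := [fset w]%fset)) ?msuppU_le // big_seq_fset1 mcoeffUU scale1r.
Qed.

End Linext.

Lemma H1E (u : H1) : u = \sum_(w <- msupp u) mcoeff w u *: wd w.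
Proof.
rewrite [LHS]monalgE; apply: eq_bigr => w _; apply/malgP => w'.
by rewrite mcoeffZ !mcoeffU mulrnAr mulr1.
Qed.

(* u |-> z_i u *)
HB.lock Definition prep (i : letter) : H1 -> H1 :=
  linext (fun w => wd (i :: w)).

Lemma prep_wd i w : prep i (wd w) = wd (i :: w).
Proof. by rewrite prep.unlock linext_wd. Qed.

Fixpoint stw (w1 : word) : word -> H1 :=
  fix stw_w1 (w2 : word) : H1 :=
    match w1, w2 with
    | [::], _ => wd w2
    | _, [::] => wd w1
    | i :: w1', j :: w2' =>
        prep i (stw w1' w2) + prep j (stw_w1 w2') + prep (addl i j) (stw w1' w2')
    end.

(* The bilinear extension of stw *)
HB.lock Definition stuffle (u v : H1) : H1 :=
  linext (fun w1 => linext (stw w1) v) u.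

Local Notation "u ** v" := (stuffle u v) (at level 40).

Lemma stuffle_wd w1 w2 : wd w1 ** wd w2 = stw w1 w2.
Proof. by rewrite stuffle.unlock !linext_wd. Qed.

Lemma stw0w w : stw [::] w = wd w. Proof. by case: w. Qed.
Lemma stww0 w : stw w [::] = wd w. Proof. by case: w. Qed.

Lemma H1_ind (P : H1 -> Prop) : P 0 ->
  (forall c u v, P u -> P v -> P (c *: u + v)) -> (forall w, P (wd w)) ->
  forall u, P u.
Proof.
move=> P0 PD Pw u; rewrite (H1E u); elim/big_rec: _ => // w v _ Pv.
exact: PD.
Qed.

Lemma prepP i c u v : prep i (c *: u + v) = c *: prep i u + prep i v.
Proof. by rewrite prep.unlock linext_is_linear. Qed.

Lemma stuffle_linearl v : linear (stuffle^~ v).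
Proof. by move=> c u1 u2; rewrite stuffle.unlock linext_is_linear. Qed.

Lemma stuffle_linearr u : linear (stuffle u).
Proof.
move=> c v1 v2; rewrite stuffle.unlock {1 3 5}/linext scaler_sumr -big_split /=.
apply: eq_bigr => w _.
by rewrite linext_is_linear scalerDr !scalerA mulrC.
Qed.

Lemma stuffle0u u : 0 ** u = 0.
Proof. by have := stuffle_linearl u (-1) 0 0; rewrite scaler0 addr0 scaleN1r addNr. Qed.

Lemma stuffleu0 u : u ** 0 = 0.
Proof. by have := stuffle_linearr u (-1) 0 0; rewrite scaler0 addr0 scaleN1r addNr. Qed.

Lemma prep0 i : prep i 0 = 0.
Proof. by have := prepP i (-1) 0 0; rewrite scaler0 addr0 scaleN1r addNr. Qed.

Lemma prepD i u v : prep i (u + v) = prep i u + prep i v.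
Proof. by have := prepP i 1 u v; rewrite !scale1r. Qed.

Lemma stuffleDl : left_distributive stuffle +%R.
Proof. by move=> u v w; have := stuffle_linearl w 1 u v; rewrite !scale1r. Qed.

Lemma stuffleDr : right_distributive stuffle +%R.
Proof. by move=> w u v; have := stuffle_linearr w 1 u v; rewrite !scale1r. Qed.

Lemma stuffleZl c u v : c *: (u ** v) = (c *: u) ** v.
Proof. by have := stuffle_linearl v c u 0; rewrite stuffle0u !addr0. Qed.

Lemma scale_sum3 (V : lmodType rat) (c : rat) (x1 x2 y1 y2 z1 z2 : V) :
  (c *: x1 + x2) + (c *: y1 + y2) + (c *: z1 + z2) =
  c *: (x1 + y1 + z1) + (x2 + y2 + z2).
Proof. by rewrite !scalerDr !addrA [LHS](ACl (1*3*5*2*4*6))%AC. Qed.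

Lemma sum3x3l (V : zmodType) (a1 b1 c1 a2 b2 c2 a3 b3 c3 : V) :
  (a1 + b1 + c1) + (a2 + b2 + c2) + (a3 + b3 + c3) =
  (a1 + a2 + a3) + b1 + c1 + b2 + c2 + b3 + c3.
Proof. by rewrite !addrA [LHS](ACl (1*4*7*2*3*5*6*8*9))%AC. Qed.

Lemma sum3x3r (V : zmodType) (a1 b1 c1 a2 b2 c2 a3 b3 c3 : V) :
  (a1 + b1 + c1) + (a2 + b2 + c2) + (a3 + b3 + c3) =
  a1 + a2 + a3 + (b1 + b2 + b3) + c1 + c2 + c3.
Proof. by rewrite !addrA [LHS](ACl (1*4*7*2*5*8*3*6*9))%AC. Qed.

Lemma stuffle_prep i j u v : prep i u ** prep j v =
  prep i (u ** prep j v) + prep j (prep i u ** v) + prep (addl i j) (u ** v).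
Proof.
elim/H1_ind: u => [|c u1 u2 IH1 IH2|a].
- by rewrite !(prep0, stuffle0u) !addr0.
- rewrite !(prepP, stuffle_linearl) IH1 IH2.
  by rewrite -scale_sum3.
elim/H1_ind: v => [|c v1 v2 IH1 IH2|b].
- by rewrite !(prep0, stuffleu0) !addr0.
- rewrite !(prepP, stuffle_linearr) IH1 IH2.
  by rewrite -scale_sum3.
by rewrite !prep_wd !stuffle_wd.
Qed.

Lemma stuffle1u : left_id (wd [::]) stuffle.
Proof.
elim/H1_ind => [|c u v IHu IHv|w]; first exact: stuffleu0.
  by rewrite stuffle_linearr IHu IHv.
by rewrite stuffle_wd stw0w.
Qed.

Lemma stuffleu1 : right_id (wd [::]) stuffle.
Proof.
elim/H1_ind => [|c u v IHu IHv|w]; first exact: stuffle0u.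
  by rewrite stuffle_linearl IHu IHv.
by rewrite stuffle_wd stww0.
Qed.

Lemma stuffleC : commutative stuffle.
Proof.
move=> u v; elim/H1_ind: u => [|c u1 u2 IH1 IH2|a].
- by rewrite stuffle0u stuffleu0.
- by rewrite stuffle_linearl stuffle_linearr IH1 IH2.
elim/H1_ind: v => [|c v1 v2 IH1 IH2|b].
- by rewrite stuffle0u stuffleu0.
- by rewrite stuffle_linearl stuffle_linearr IH1 IH2.
elim: a b => [|i a IHa] b; first by rewrite stuffle1u stuffleu1.
elim: b => [|j b IHb]; first by rewrite stuffle1u stuffleu1.
rewrite -(prep_wd i) -(prep_wd j) !stuffle_prep !prep_wd.
by rewrite IHb !IHa addlC (addrC (prep i _)).
Qed.

Section AssocStep.
Variables (V : zmodType) (m : V -> V -> V) (p : letter -> V -> V).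
Hypotheses (mDl : left_distributive m +%R) (mDr : right_distributive m +%R).
Hypothesis pD : forall i u v, p i (u + v) = p i u + p i v.
Hypothesis mp : forall i j u v, m (p i u) (p j v) =
  p i (m u (p j v)) + p j (m (p i u) v) + p (addl i j) (m u v).

Lemma assoc_step i j k A B C :
  m A (m (p j B) (p k C)) = m (m A (p j B)) (p k C) ->
  m A (m (p j B) C) = m (m A (p j B)) C ->
  m A (m B (p k C)) = m (m A B) (p k C) ->
  m A (m B C) = m (m A B) C ->
  m (p i A) (m B (p k C)) = m (m (p i A) B) (p k C) ->
  m (p i A) (m B C) = m (m (p i A) B) C ->
  m (p i A) (m (p j B) C) = m (m (p i A) (p j B)) C ->
  m (p i A) (m (p j B) (p k C)) = m (m (p i A) (p j B)) (p k C).
Proof.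
move=> L1 L2 L3 L4 L5 L6 L7.
have -> : m (p i A) (m (p j B) (p k C)) =
    p i (m A (m (p j B) (p k C))) + p j (m (p i A) (m B (p k C)))
    + p (addl i j) (m A (m B (p k C)))
    + p k (m (p i A) (m (p j B) C)) + p (addl i k) (m A (m (p j B) C))
    + p (addl j k) (m (p i A) (m B C))
    + p (addl i (addl j k)) (m A (m B C)).
  rewrite (mp j k) !mDr !pD (mp i j) (mp i k) (mp i (addl j k)).
  exact: sum3x3l.
have -> : m (m (p i A) (p j B)) (p k C) =
    p i (m (m A (p j B)) (p k C)) + p j (m (m (p i A) B) (p k C))
    + p (addl i j) (m (m A B) (p k C))
    + p k (m (m (p i A) (p j B)) C) + p (addl i k) (m (m A (p j B)) C)
    + p (addl j k) (m (m (p i A) B) C)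
    + p (addl (addl i j) k) (m (m A B) C).
  rewrite (mp i j) !mDl !pD (mp i k) (mp j k) (mp (addl i j) k).
  exact: sum3x3r.
by rewrite L1 L2 L3 L4 L5 L6 L7 addlA.
Qed.

End AssocStep.

Lemma stuffleA : associative stuffle.
Proof.
have stA a b c : wd a ** (wd b ** wd c) = (wd a ** wd b) ** wd c.
  elim: a b c => [|i a IHa] b c; first by rewrite !stuffle1u.
  elim: b c => [|j b IHb] c; first by rewrite stuffle1u stuffleu1.
  elim: c => [|k c IHc]; first by rewrite !stuffleu1.
  move: (IHa (j :: b) (k :: c)) (IHa (j :: b) c) (IHa b (k :: c)) (IHa b c).
  move: (IHb (k :: c)) (IHb c) IHc; rewrite -!prep_wd => L5 L6 L7 L1 L2 L3 L4.
  exact: (@assoc_step H1 stuffle prep stuffleDl stuffleDr prepD stuffle_prep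
    i j k (wd a) (wd b) (wd c) L1 L2 L3 L4 L5 L6 L7).
move=> u v w; elim/H1_ind: u => [|c u1 u2 IH1 IH2|a].
- by rewrite !stuffle0u.
- by rewrite !stuffle_linearl IH1 IH2.
elim/H1_ind: v => [|c v1 v2 IH1 IH2|b].
- by rewrite !(stuffle0u, stuffleu0).
- by rewrite !(stuffle_linearl, stuffle_linearr) IH1 IH2.
elim/H1_ind: w => [|c w1 w2 IH1 IH2|c]; last exact: stA.
- by rewrite !stuffleu0.
- by rewrite !stuffle_linearr IH1 IH2.
Qed.

Lemma wd0_neq0 : wd [::] != 0.
Proof. by rewrite monalgU_eq0. Qed.

HB.instance Definition _ := GRing.Zmodule_isComNzRing.Build H1
  stuffleA stuffleC stuffle1u stuffleDl wd0_neq0.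
HB.instance Definition _ := GRing.Lmodule_isLalgebra.Build rat H1 stuffleZl.
HB.instance Definition _ := GRing.Lalgebra_isComAlgebra.Build rat H1.

Lemma wd_nil : wd [::] = 1 :> H1. Proof. by []. Qed.

Lemma wd_mul w1 w2 : wd w1 * wd w2 = stw w1 w2.
Proof. exact: stuffle_wd. Qed.

(* The words that are empty or whose first letter is z_i with i > 1 *)
Definition admissible (w : word) : bool :=
  if w is i :: _ then (1 < val i)%N else true.

Definition H0_pred : {pred H1} := fun u => all admissible (msupp u).

Lemma H0_predP (u : H1) :
  reflect (forall w, mcoeff w u != 0 -> admissible w) (u \in H0_pred).
Proof.
apply: (iffP allP) => h w; first by rewrite mcoeff_neq0; exact: h.
by move=> wu; apply: h; rewrite mcoeff_neq0.
Qed.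

Lemma H0_linear : linear_closed H0_pred.
Proof.
move=> c u v /H0_predP hu /H0_predP hv; apply/H0_predP => w.
rewrite mcoeffD mcoeffZ.
have [->|/hu//] := eqVneq (mcoeff w u) 0.
by rewrite mulr0 add0r; exact: hv.
Qed.

Lemma H0_0 : 0 \in H0_pred.
Proof. by apply/H0_predP => w; rewrite mcoeff0 eqxx. Qed.

Lemma H0_D u v : u \in H0_pred -> v \in H0_pred -> u + v \in H0_pred.
Proof. by move=> hu hv; rewrite -[u]scale1r; exact: H0_linear. Qed.

Lemma H0_wd w : admissible w -> wd w \in H0_pred.
Proof.
move=> hw; apply/H0_predP => w'; rewrite mcoeffU.
by have [<-|] := eqVneq w w'; rewrite ?mulr0n ?eqxx.
Qed.

(* H0_pred is the span of the admissible words *)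
Lemma H0_spanP (u : H1) :
  u \in H0_pred <->
  exists2 s : seq (rat * word), all (fun p => admissible p.2) s &
    u = \sum_(p <- s) p.1 *: wd p.2.
Proof.
split=> [/allP hu|[s /allP hs ->]].
  exists [seq (mcoeff w u, w) | w <- msupp u].
    by rewrite all_map; apply/allP => w /hu.
  by rewrite big_map; exact: H1E.
rewrite big_seq; elim/big_rec: _ => [|p v ps hv]; first exact: H0_0.
by apply: H0_linear => //; apply/H0_wd/hs.
Qed.

Lemma H0_prep (i : letter) u : (1 < val i)%N -> prep i u \in H0_pred.
Proof.
move=> hi; elim/H1_ind: u => [|c u v hu hv|w].
- by rewrite prep0; exact: H0_0.
- by rewrite prepP; exact: H0_linear.
- by rewrite prep_wd; exact: H0_wd.
Qed.

Lemma H0_stw w1 w2 : admissible w1 -> admissible w2 -> stw w1 w2 \in H0_pred.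
Proof.
case: w1 w2 => [|i w1] [|j w2] hi hj; try exact: H0_wd.
rewrite /=; apply: H0_D; first by apply: H0_D; exact: H0_prep.
by apply: H0_prep; rewrite /= ltn_addr.
Qed.

Lemma H0_mul : GRing.mulr_2closed H0_pred.
Proof.
move=> u v /H0_spanP[s /allP hs ->] /H0_spanP[r /allP hr ->].
rewrite big_seq mulr_suml; elim/big_rec: _ => [|p x ps hx]; first exact: H0_0.
apply: H0_D => //; rewrite big_seq mulr_sumr.
elim/big_rec: _ => [|q y qr hy]; first exact: H0_0.
apply: H0_D => //; rewrite -scalerAl -scalerAr scalerA -[X in X \in _]addr0.
apply: H0_linear; last exact: H0_0.
by rewrite wd_mul; apply: H0_stw; [exact: hs|exact: hr].
Qed.

Lemma H0_subalg_closed : subalg_closed H0_pred.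
Proof. by split; [exact: H0_wd|exact: H0_linear|exact: H0_mul]. Qed.

HB.instance Definition _ :=
  GRing.isSubalgClosed.Build rat H1 H0_pred H0_subalg_closed.

Definition H0 : Type := {u : H1 | u \in H0_pred}.
HB.instance Definition _ := SubChoice.on H0.
HB.instance Definition _ := [SubChoice_isSubComNzRing of H0 by <:].
HB.instance Definition _ := [SubZmodule_isSubLmodule of H0 by <:].
HB.instance Definition _ := [SubNzRing_SubLmodule_isSubLalgebra of H0 by <:].
HB.instance Definition _ := [SubLalgebra_isSubAlgebra of H0 by <:].

Definition wd0 (w : word) (hw : admissible w) : H0 := Sub (wd w) (H0_wd hw).

(* The terms are nonnegative, so the multiple series is an unordered sum. It is
   finite if k = 0 or i_1 > 1; if i_1 = 1 it diverges and t is 0 by convention. *)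
Definition t (R : realType) (k : nat) (i : k.-tuple letter) : R :=
  fine (\esum_(n in [set n : k.-tuple nat | sorted gtn n && all odd n])
    (\prod_(j < k) (tnth n j)%:R ^- val (tnth i j))%:E).

Section Theta.
Variable R : realType.

Definition theta_fun (u : H0) : R :=
  \sum_(w <- msupp (val u)) ratr (mcoeff w (val u)) * t R (in_tuple w).

Lemma theta_funE (d : {fset word}) (u : H0) : (msupp (val u) `<=` d)%fset ->
  theta_fun u = \sum_(w <- d) ratr (mcoeff w (val u)) * t R (in_tuple w).
Proof.
move=> le; rewrite [LHS](big_fset_incl _ le) => //= x xd /mcoeff_outdom ->.
by rewrite rmorph0 mul0r.
Qed.

Lemma theta_fun_linear : linear_for (ratr \; *%R) theta_fun.
Proof.
move=> c u v.
pose d := (msupp (val u) `|` msupp (val v))%fset.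
have du : (msupp (val u) `<=` d)%fset by apply: fsubsetUl.
have dv : (msupp (val v) `<=` d)%fset by apply: fsubsetUr.
have duv : (msupp (val (c *: u + v)%R) `<=` d)%fset.
  apply: fsubset_trans (msuppD_le _ _) _; apply: fsetSU; exact: msuppZ_le.
rewrite (theta_funE du) (theta_funE dv) (theta_funE duv) /= mulr_sumr.
rewrite -big_split /=; apply: eq_bigr => w _.
by rewrite mcoeffD mcoeffZ rmorphD rmorphM mulrDl mulrA.
Qed.

HB.instance Definition _ :=
  GRing.isLinear.Build rat H0 R _ theta_fun theta_fun_linear.

Lemma theta_fun_wd0 (w : word) (hw : admissible w) :
  theta_fun (wd0 hw) = t R (in_tuple w).
Proof.
rewrite (theta_funE (d := [fset w]%fset)) ?msuppU_le // big_seq_fset1.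
by rewrite mcoeffUU rmorph1 mul1r.
Qed.

Lemma t_nil (i : 0.-tuple letter) : t R i = 1.
Proof.
rewrite /t (_ : [set n | _] = [set [tuple]])%classic.
  by rewrite esum_set1 big_ord0 ?lee01.
by apply/seteqP; split=> n /=; rewrite (tuple0 n).
Qed.

Lemma t_in_tuple (k : nat) (i : k.-tuple letter) : t R (in_tuple i) = t R i.
Proof.
case: i => s hs; have e := eqP hs; move: hs; case: k / e => hs.
by congr (t R _); exact: val_inj.
Qed.

(* {linear H0 -> R | ratr \; *%R}: Q-linear, Q acting on R through ratr *)
Lemma theta_exists : exists theta : {linear H0 -> R | ratr \; *%R},
  theta 1 = 1 /\
  forall (k : nat) (i : k.+1.-tuple letter) (hi : admissible i),
    theta (wd0 hi) = t R i.
Proof.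
exists theta_fun; split=> [|k i hi].
  have -> : (1 : H0) = wd0 (w := [::]) isT by exact: val_inj.
  by rewrite /= theta_fun_wd0; exact: t_nil.
by rewrite /= theta_fun_wd0 t_in_tuple.
Qed.

Lemma theta_unique (f g : {linear H0 -> R | ratr \; *%R}) :
  f 1 = g 1 ->
  (forall (k : nat) (i : k.+1.-tuple letter) (hi : admissible i),
    f (wd0 hi) = g (wd0 hi)) ->
  f =1 g.
Proof.
move=> fg1 fg u.
have fgw (w : word) (hw : admissible w) : f (wd0 hw) = g (wd0 hw).
  case: w hw => [|i w] hw; last exact: (fg _ (in_tuple (i :: w)) hw).
  by rewrite (_ : wd0 hw = 1) //; exact: val_inj.
have [s hs uE] := (H0_spanP (val u)).1 (valP u).
elim: s u hs uE => [|p s IHs] u /= => [_|/andP[hp hs]].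
  by rewrite big_nil => u0; rewrite (_ : u = 0) ?linear0 //; exact: val_inj.
rewrite big_cons => uE.
have [v vE uv] : exists2 v : H0,
    val v = \sum_(q <- s) q.1 *: wd q.2 & u = p.1 *: wd0 hp + v.
  exists (u - p.1 *: wd0 hp); last by rewrite addrC subrK.
  by rewrite rmorphB /= uE addrC addKr.
by rewrite uv !linearD !linearZ /= fgw (IHs v).
Qed.

End Theta.

(* Main.v *)
(** Truncate the series of t(i_1,...,i_k) to N > n_1 > ... > n_k. Splitting off
    the terms with n_1 = N gives
      T_(N+1)(z_i u) = T_N(z_i u) + a_i T_N(u),  a_i = N^-i (N odd) or 0 (N even),
    and a_(i+j) = a_i a_j; so, by induction on N alone, the linear extension of
    T_N is multiplicative for the stuffle product on all of H^1. On admissible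
    words T_N is bounded (T_N(w) = O(sqrt N) for every word w, hence the
    truncations of z_i w with i > 1 are dominated by the sum of n^(-3/2)),
    so T_N converges to theta on H^0 and multiplicativity passes to the limit. *)
Require Import Defs.
From mathcomp Require Import all_boot all_order all_algebra.
From mathcomp Require Import all_classical all_reals all_analysis.
From mathcomp Require Import ring lra.
Import Order.TTheory GRing.Theory Num.Theory.
Import numFieldNormedType.Exports.
Local Open Scope classical_set_scope.
Local Open Scope ring_scope.

(** * Truncated sums and their multiplicativity *)

(* Vanishing at even [N] keeps [odd_pow N] multiplicative in the letter. *)
Definition odd_pow (N : nat) (i : letter) : rat :=
  if odd N then N%:R ^- val i else 0.

Lemma odd_powM N i j : odd_pow N (addl i j) = odd_pow N i * odd_pow N j.
Proof.
by rewrite /odd_pow; case: ifP => _; rewrite ?mulr0// exprD invfM.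
Qed.

Lemma odd_pow_ge0 N i : 0 <= odd_pow N i.
Proof. by rewrite /odd_pow; case: ifP => // _; rewrite invr_ge0 exprn_ge0. Qed.

(* The truncation of t to indices N > n_1 > ... > n_k *)
Fixpoint tsum (N : nat) (w : word) : rat :=
  match N, w with
  | _, [::] => 1
  | 0%N, _ :: _ => 0
  | M.+1, i :: w' => tsum M w + odd_pow M i * tsum M w'
  end.

Lemma tsum_nil N : tsum N [::] = 1. Proof. by case: N. Qed.

Lemma tsumS N i w :
  tsum N.+1 (i :: w) = tsum N (i :: w) + odd_pow N i * tsum N w.
Proof. by []. Qed.

Lemma tsum_ge0 N w : 0 <= tsum N w.
Proof.
elim: N w => [|N IH] [|i w] //=.
by rewrite addr_ge0 ?mulr_ge0 ?odd_pow_ge0.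
Qed.

Definition tsumL (N : nat) : H1 -> rat :=
  linext (tsum N : word -> rat^o).

Lemma tsumL_wd N w : tsumL N (wd w) = tsum N w.
Proof. by rewrite /tsumL linext_wd. Qed.

Lemma tsumLP N c u v : tsumL N (c *: u + v) = c * tsumL N u + tsumL N v.
Proof. by rewrite /tsumL linext_is_linear. Qed.

Lemma tsumL0 N : tsumL N 0 = 0.
Proof. by have := tsumLP N (-1) 0 0; rewrite scaler0 addr0 mulN1r addNr. Qed.

Lemma tsumLD N u v : tsumL N (u + v) = tsumL N u + tsumL N v.
Proof. by have := tsumLP N 1 u v; rewrite scale1r mul1r. Qed.

Lemma tsumL_prep0 i u : tsumL 0 (prep i u) = 0.
Proof.
elim/H1_ind: u => [|c u v hu hv|w]; first by rewrite prep0 tsumL0.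
  by rewrite prepP tsumLP hu hv mulr0 addr0.
by rewrite prep_wd tsumL_wd.
Qed.

(** Extends the recursion [tsumS] by linearity, because a stuffle product of words is a combination
    of words rather than a word. *)
Lemma tsumL_prepS N i u :
  tsumL N.+1 (prep i u) = tsumL N (prep i u) + odd_pow N i * tsumL N u.
Proof.
elim/H1_ind: u => [|c u v hu hv|w].
- by rewrite prep0 !tsumL0 mulr0 addr0.
- by rewrite prepP !tsumLP hu hv !mulrDr addrACA mulrCA.
- by rewrite prep_wd !tsumL_wd.
Qed.

(** For x = z_i a and y = z_j b, passing from N to N+1 in the three stuffle terms adds a_i T(a y),
    a_j T(x b) and a_i a_j T(a b) to T(x y). By induction the total is the expansion of (T(x) + a_i
    T(a)) (T(y) + a_j T(b)). *)
Lemma tsumLM N : {morph tsumL N : u v / u * v}.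
Proof.
move=> u v; elim/H1_ind: u => [|c u1 u2 IH1 IH2|a].
- by rewrite mul0r tsumL0 mul0r.
- by rewrite mulrDl -scalerAl !tsumLP IH1 IH2 mulrDl mulrA.
elim/H1_ind: v => [|c v1 v2 IH1 IH2|b].
- by rewrite mulr0 tsumL0 mulr0.
- by rewrite mulrDr -scalerAr !tsumLP IH1 IH2 mulrDr mulrCA.
have mul_prep i j x y : prep i x * prep j y =
    prep i (x * prep j y) + prep j (prep i x * y) + prep (addl i j) (x * y).
  exact: stuffle_prep.
(* Both words stay general, since the hypothesis is used at four pairs of words. Cases with an empty
   word close at once, [wd [::]] being the unit. *)
elim: N a b => [|N IHN] [|i a] [|j b];
  rewrite ?wd_nil ?mul1r ?mulr1 -?wd_nil ?[tsumL _ (wd [::])]tsumL_wd ?tsum_nil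
    ?mul1r ?mulr1 // -!prep_wd mul_prep !tsumLD.
- by rewrite !tsumL_prep0 mulr0 !addr0.
- rewrite !tsumL_prepS odd_powM !prep_wd.
  have := IHN (i :: a) (j :: b); rewrite -!prep_wd mul_prep !tsumLD !prep_wd.
  rewrite (IHN a (j :: b)) (IHN (i :: a) b) (IHN a b).
  move: (tsumL N (wd (i :: a))) (tsumL N (wd (j :: b))) => A B AB.
  rewrite mulrDl !mulrDr -AB; ring.
Qed.

(** * Truncations as sums over index tuples *)

Definition incr_odd (N k : nat) : set (k.-tuple nat) :=
  [set n | [&& sorted gtn n, all odd n & all (gtn N) n]].


Lemma incr_odd_cons N k x (s : k.-tuple nat) :
  incr_odd N.+1 k.+1 [tuple of x :: s] <->
  [/\ odd x, (x <= N)%N & incr_odd x k s].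
Proof.
rewrite /incr_odd /= path_sortedE; last by move=> y x' z /= yx /ltn_trans; apply.
split=> [/and3P[/andP[xs ss] /andP[ox os] /andP[xN _]]|[ox xN /and3P[ss os xs]]].
  by split => //; apply/and3P.
rewrite xs ss ox os ltnS xN /=; apply: sub_all xs => y /= yx.
exact: leq_trans yx (leqW xN).
Qed.

(** The head is the largest entry: either it is below [N], or it equals [N], which is then odd, and
    the tail lies below [N]. This mirrors the recursion of [tsum]. *)
Lemma incr_oddS N k : incr_odd N.+1 k.+1 =
  (incr_odd N k.+1) `|`
  (if odd N then (fun n => [tuple of N :: n]) @` incr_odd N k else set0).
Proof.
apply/seteqP; split=> [n|n].
  case/tupleP: n => x s /incr_odd_cons[ox].
  rewrite leq_eqVlt => /orP[/eqP <- xs|xN xs].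
    by right; rewrite ox; exists s.
  left; case: N xN => // N xN; exact/incr_odd_cons.
case=> [|].
  case/tupleP: n => x s; case: N => [|N].
    by rewrite /incr_odd /= !andbF.
  by move=> /incr_odd_cons[ox xN xs]; apply/incr_odd_cons; split=> //; exact: leqW.
by case: ifP => // oN [s sN <-]; exact/incr_odd_cons.
Qed.

(* The factor [c] makes the induction hypothesis absorb the leading power of [N]. *)
Lemma esum_tsum (R : realType) (N : nat) (w : word) (c : R) : 0 <= c ->
  \esum_(n in incr_odd N (size w))
    (c * \prod_(j < size w) (tnth n j)%:R ^- val (tnth (in_tuple w) j))%:E =
  (c * ratr (tsum N w))%:E.
Proof.
have nil M d : 0 <= d -> \esum_(n in incr_odd M 0)
    (d * \prod_(j < 0) (tnth n j)%:R ^- val (tnth (in_tuple [::] : 0.-tuple letter) j))%:E =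
    (d * ratr (tsum M [::]))%:E :> \bar R.
  move=> d0; rewrite (_ : incr_odd M 0 = [set [tuple]]).
    by rewrite esum_set1 ?lee_fin big_ord0 ?mulr1 ?tsum_nil ?rmorph1 ?mulr1.
  by apply/seteqP; split=> n /=; rewrite (tuple0 n).
elim: N w c => [|N IHN] [|i w] c c0; try exact: nil.
  rewrite [tsum _ _]/= rmorph0 mulr0 (_ : incr_odd 0 _ = set0) ?esum_set0 //.
  by apply/seteqP; split=> // n; case/tupleP: n => x s; rewrite /incr_odd /= !andbF.
have F0 n : incr_odd N.+1 (size (i :: w)) n -> (0 <=
    (c * \prod_(j < size (i :: w)) (tnth n j)%:R ^- val (tnth (in_tuple (i :: w)) j))%:E)%E.
  by move=> _; rewrite lee_fin mulr_ge0 // prodr_ge0.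
rewrite (esumID (incr_odd N (size w).+1) _ _ F0) incr_oddS.
rewrite setIUl setIid setUidl; last exact: subIsetr.
rewrite (IHN (i :: w)) // setIUl setICr set0U tsumS /odd_pow rmorphD mulrDr EFinD.
congr (_ + _)%E; case: ifP => oN; last first.
  by rewrite set0I esum_set0 mul0r rmorph0 mulr0.
(* A tuple headed by [N] is not bounded by [N], so the two pieces are disjoint. *)
rewrite setIidl; last first.
  move=> _ [s _ <-] /=; rewrite /incr_odd /= => /and3P[_ _ /andP[]].
  by rewrite ltnn.
rewrite esum_image; last by move=> s s' _ _ [] /val_inj.
rewrite rmorphM /= fmorphV rmorphXn /= ratr_nat mulrA -IHN; last first.
  by rewrite mulr_ge0 // invr_ge0 exprn_ge0.
apply: eq_esum => s _; congr (_%:E).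
rewrite big_ord_recl -mulrA; congr (_ * (_ * _)).
by apply: eq_bigr => j _; rewrite !(tnth_nth 0%N, tnth_nth i).
Qed.

(** * Growth and convergence of the truncations *)

Lemma tsum_le w : {homo tsum^~ w : m n / (m <= n)%N >-> m <= n}.
Proof.
apply: homo_leq => [//|x y z|N]; first exact: le_trans.
case: w => [|i w]; first by rewrite !tsum_nil.
by rewrite tsumS lerDl mulr_ge0 ?odd_pow_ge0 ?tsum_ge0.
Qed.

Section Limit.
Variable R : realType.

(** The shift keeps the root positive and makes [odd_pow N.+1 i] zero or a power of [(r N)^-1], so
    the estimates become polynomial inequalities in [r N] and [r N.+1]. *)
Let r (N : nat) : R := Num.sqrt N.+1%:R.

Let r_gt0 N : 0 < r N. Proof. by rewrite sqrtr_gt0 ltr0n. Qed.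

Let r_sqr N : r N ^+ 2 = N.+1%:R. Proof. by rewrite sqr_sqrtr ?ler0n. Qed.

Let r_sqrS N : r N.+1 ^+ 2 = r N ^+ 2 + 1.
Proof. by rewrite !r_sqr -natr1. Qed.

Let r_lt N : r N < r N.+1.
Proof. by rewrite ltr_sqrt ?ltr0n // ltr_nat. Qed.

Let r_le N : r N.+1 <= 2 * r N.
Proof.
have r1 : 1 <= r N ^+ 2 by rewrite r_sqr ler1n.
have := r_gt0 N; have := r_gt0 N.+1; have := r_sqrS N; nra.
Qed.

(** Used with [m = 1] for an arbitrary letter and with [m = 2] for the first letter of an admissible
    word. *)
Let odd_pow_le N i m : (m <= val i)%N ->
  ratr (odd_pow N.+1 i) <= (r N)^-1 ^+ m.*2 :> R.
Proof.
move=> mi; rewrite -muln2 mulnC exprM exprVn r_sqr /odd_pow.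
case: ifP => _; last by rewrite rmorph0 exprn_ge0 // invr_ge0.
rewrite fmorphV rmorphXn /= ratr_nat -exprVn ler_wiXn2l //.
by rewrite invf_le1 ?ltr0n // ler1n.
Qed.

(** Each letter costs a factor 3: the increment is at most [c * (r N)^-1], with [c] the constant of
    the tail, and this is at most [3 * c * (r N.+1 - r N)], which telescopes. *)
Lemma tsum_le_sqrt N w : ratr (tsum N.+1 w) <= 3 ^+ size w * Num.sqrt N.+1%:R :> R.
Proof.
elim: w N => [|i w IHw] N.
  rewrite tsum_nil rmorph1 expr0 mul1r -[leLHS]sqrtr1 ler_sqrt ?ltr0n //.
  by rewrite ler1n.
elim: N => [|N IHN].
  (* [tsum 1] only adds the index 0, which is even and contributes nothing. *)
  by rewrite tsumS /odd_pow mul0r addr0 rmorph0 mulr_ge0 // exprn_ge0.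
rewrite tsumS rmorphD rmorphM /=.
apply: le_trans (lerD IHN (ler_pM _ _ (odd_pow_le _ _ 1 (valP i)) (IHw N))) _.
- by rewrite ler0q odd_pow_ge0.
- by rewrite ler0q tsum_ge0.
rewrite -!/(r _) [size (_ :: _)]/= exprS.
set c := 3 ^+ size w; have c0 : 0 <= c by rewrite exprn_ge0.
have -> : (r N)^-1 ^+ 1.*2 * (c * r N) = c * (r N)^-1.
  by field; rewrite gt_eqF.
rewrite mulrAC [leRHS]mulrAC -[X in _ + X]mulr1 ![_ * c]mulrC -!mulrA -mulrDr.
rewrite ler_wpM2l //.
(* [r N.+1 - r N = 1 / (r N.+1 + r N)] and [r N.+1 <= 2 * r N] *)
have h : (r N)^-1 <= 3 * (r N.+1 - r N).
  rewrite -(ler_pM2l (r_gt0 N)) divff ?gt_eqF //.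
  have := r_gt0 N; have := r_lt N; have := r_sqrS N; have := r_le N; nra.
lra.
Qed.

(** The first letter gives a factor at most [(r N)^-1 ^+ 4] against [c * r N] for the tail, so the
    increments are at most [c * (r N)^-1 ^+ 3], which is summable. *)
Lemma tsum_bounded w : admissible w ->
  exists C : R, forall N, ratr (tsum N w) <= C.
Proof.
case: w => [_|i w /= i1].
  by exists 1 => N; rewrite tsum_nil rmorph1.
pose c : R := 3 ^+ size w; have c0 : 0 <= c by rewrite exprn_ge0.
(* The bound telescopes: [x^-3 <= 6 (x^-1 - y^-1)] for [x = r N], [y = r N.+1]. *)
suff H N : ratr (tsum N.+1 (i :: w)) <= 6 * c * (1 - (r N)^-1).
  exists (6 * c) => N; apply: (@le_trans _ _ (ratr (tsum N.+1 (i :: w)))).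
    by rewrite ler_rat tsum_le.
  apply: le_trans (H N) _; rewrite ler_piMr ?mulr_ge0 //.
  by rewrite gerBl invr_ge0 ltW.
elim: N => [|N IHN].
  rewrite tsumS /odd_pow mul0r addr0 rmorph0 /r sqrtr1 invr1 subrr mulr0.
  by [].
rewrite tsumS rmorphD rmorphM /=.
apply: le_trans (lerD IHN (ler_pM _ _ (odd_pow_le _ _ 2 i1) (tsum_le_sqrt N w))) _.
- by rewrite ler0q odd_pow_ge0.
- by rewrite ler0q tsum_ge0.
rewrite -!/(r _) -/c.
have -> : (r N)^-1 ^+ 2.*2 * (c * r N) = c * (r N)^-1 ^+ 3.
  by field; rewrite gt_eqF.
have h : (r N)^-1 ^+ 3 <= 6 * ((r N)^-1 - (r N.+1)^-1).
  have -> : (r N)^-1 - (r N.+1)^-1 = (r N.+1 - r N) / (r N * r N.+1).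
    by field; rewrite !gt_eqF.
  have -> : (r N)^-1 ^+ 3 = r N.+1 / r N ^+ 2 / (r N * r N.+1).
    by field; rewrite !gt_eqF.
  rewrite mulrA ler_pM2r ?invr_gt0 ?mulr_gt0 // ler_pdivrMr ?exprn_gt0 //.
  have := r_gt0 N; have := r_lt N; have := r_sqrS N; have := r_le N.
  move: (r N) (r N.+1) => x y y2 yx xy x0.
  (* The goal is now [y <= 6 * (y - x) * x ^+ 2]. Since [y <= 2 * x], the sum [y + x] is at most
     [3 * x], which gives [e3]; multiplying it by [2 * x] suffices. *)
  have e : (y - x) * (y + x) = 1 by lra.
  have d : 0 < y - x by lra.
  have e3 : 1 <= 3 * x * (y - x) by nra.
  have : 2 * x <= 6 * x ^+ 2 * (y - x) by nra.
  lra.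
nra.
Qed.

(** The unordered sum is the supremum of the increasing truncations, because a finite set of index
    tuples lies below some [N]. *)
Lemma tsum_cvg w : admissible w -> ratr (tsum N w) @[N --> \oo] --> t R (in_tuple w).
Proof.
move=> /tsum_bounded[C tC]; rewrite /t.
pose F (n : (size w).-tuple nat) : \bar R :=
  (\prod_(j < size w) (tnth n j)%:R ^- val (tnth (in_tuple w) j))%:E.
rewrite -/F.
have F0 n : (0 <= F n)%E by rewrite lee_fin prodr_ge0.
have incr_sum N : \esum_(n in incr_odd N (size w)) F n = (ratr (tsum N w))%:E.
  rewrite -[ratr _ in RHS]mul1r -esum_tsum //; apply: eq_esum => n _.
  by rewrite mul1r.
have -> : \esum_(n in [set n : (size w).-tuple nat | sorted gtn n && all odd n]) F n =
    ereal_sup (range (fun N => (ratr (tsum N w))%:E)).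
  apply/eqP; rewrite eq_le; apply/andP; split.
    apply: ge_ereal_sup => _ [X [Xfin XA] <-].
    have /finite_seqP[s Xs] := Xfin.
    (* Exceeds every entry of every tuple in [X]. *)
    pose N := (\max_(n <- s) \max_(j < size w) tnth n j).+1.
    apply: (@le_trans _ _ (ratr (tsum N w))%:E); last first.
      by apply: ereal_sup_ubound; exists N.
    rewrite -incr_sum; apply: ereal_sup_ubound; exists X => //; split=> // n Xn.
    have /andP[ns no] := XA n Xn; rewrite /incr_odd /= ns no /=.
    apply/all_tnthP => j /=; rewrite ltnS.
    apply: leq_trans (leq_bigmax j) _.
    apply: (@leq_bigmax_seq _ _ _ (fun n => \max_(j < size w) tnth n j)%N) => //.
    by move: Xn; rewrite Xs.
  apply: ge_ereal_sup => _ [N _ <-]; rewrite -incr_sum.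
  apply: le_ereal_sup => _ [X [Xfin XA] <-]; exists X => //; split=> // n /XA.
  by move=> /and3P[ns no _]; apply/andP.
have cv : (ratr (tsum N w))%:E @[N --> \oo] -->
    ereal_sup (range (fun N => (ratr (tsum N w))%:E : \bar R)).
  by apply: ereal_nondecreasing_cvgn => m n mn; rewrite lee_fin ler_rat tsum_le.
apply: (fine_cvg (f := fun N => (ratr (tsum N w))%:E)).
(* The bound [C] makes the supremum finite; at infinity [fine] would return 0. *)
rewrite fineK //; apply/fin_real/andP; split.
  apply: lt_le_trans (ltNyr 0) _; apply: (@le_trans _ _ (ratr (tsum 0 w))%:E).
    by rewrite lee_fin ler0q tsum_ge0.
  by apply: ereal_sup_ubound; exists 0%N.
apply: le_lt_trans (ltry C); apply: ge_ereal_sup => _ [N _ <-].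
by rewrite lee_fin.
Qed.

Lemma theta_fun_cvg (u : H0) :
  ratr (tsumL N (val u)) @[N --> \oo] --> theta_fun R u.
Proof.
have /allP hu := valP u.
rewrite /theta_fun big_seq.
under eq_fun => N.
  rewrite /tsumL /linext rmorph_sum big_seq.
  under eq_bigr do rewrite rmorphM /=.
  over.
apply: cvg_big => [|w /hu hw]; first exact: add_continuous.
by apply: cvgM; [exact: cvg_cst|exact: tsum_cvg].
Qed.

End Limit.

(** * Passage to the limit *)

Theorem theorem2p3 (R : realType) (theta : {linear H0 -> R | ratr \; *%R}) :
  theta 1 = 1 ->
  (forall (k : nat) (i : k.+1.-tuple letter) (hi : admissible i),
    theta (wd0 hi) = t R i) ->
  forall u v : H0, theta (u * v) = theta u * theta v.
Proof.
move=> theta1 thetaw.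
(* Uniqueness reduces the claim to [theta_fun], whose values are known limits. *)
have thetaE : theta =1 theta_fun R.
  apply: (@theta_unique R theta (theta_fun R)) => [|k i hi].
    rewrite theta1 (_ : 1 = wd0 (w := [::]) isT); last exact: val_inj.
    by rewrite /= theta_fun_wd0 t_nil.
  by rewrite thetaw /= theta_fun_wd0 t_in_tuple.
move=> u v; rewrite !thetaE.
have tM N : ratr (tsumL N (val (u * v))) =
    ratr (tsumL N (val u)) * ratr (tsumL N (val v)) :> R.
  by rewrite -rmorphM -tsumLM.
have cuv : ratr (tsumL N (val (u * v))) @[N --> \oo] -->
    theta_fun R u * theta_fun R v.
  rewrite (funext tM).
  exact: cvgM (theta_fun_cvg R u) (theta_fun_cvg R v).
exact: (cvg_unique (@Rhausdorff R) (theta_fun_cvg R (u * v)) cuv).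
Qed.
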